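(* Let $A$ be a real finite-dimensional affine space and $m\in\mathrm{Met}(A)$ a non-degenerate metric. Then any affine referential $(R_0,\dots,R_n)$ of $A$ determines a basis $(\delta^m_{R_0},\dots,\delta^m_{R_n},u_m)$ of $\widehat{\mathrm{Quad}_mA}$.
   Context: All spaces are real and finite-dimensional. $A$ has director vector space $\vec A$; $\mathrm{Aff}(A)$ is the vector space of affine functions $A\to\mathbb R$, $u$ the constant function $1$. An affine referential of $A$ ($n=\dim A$) is a sequence of $n+1$ affinely independent points. A function $\delta:A\to\mathbb R$ is quadratic if $\delta(\alpha P+\beta Q)=\alpha(\alpha-\beta)\delta(P)+\beta(\beta-\alpha)\delta(Q)+4\alpha\beta\,\delta(\frac{P+Q}2)$ for all $P,Q\in A$ and $\alpha+\beta=1$; $\mathrm{Quad}(A)$ is the vector space of these. Each $\delta\in\mathrm{Quad}(A)$ has a symmetric bilinear form $\mathrm{Hess}\,\delta$ on $\vec A$ (hessian principal component), characterized by $\frac12(\delta(Q)+\delta(2P-Q))-\delta(P)=\frac12\mathrm{Hess}\,\delta(\overrightarrow{PQ},\overrightarrow{PQ})$ for all $P,Q\in A$. $\mathrm{Met}(A)=\mathrm{Quad}(A)/\mathrm{Aff}(A)$ is the space of metrics; for $m\in\mathrm{Met}(A)$, $\mathrm{Quad}_mA\subset\mathrm{Quad}(A)$ is the class $m$, an affine space with director space $\mathrm{Aff}(A)$; its elements share the same hessian principal component $g$ (that of $m$). $m$ is non-degenerate if $g$ has trivial nullspace. $\delta^m_P\in\mathrm{Quad}_mA$ is $\delta^m_P(Q)=\frac12g(\overrightarrow{PQ},\overrightarrow{PQ})$.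 $\mathrm{Aff}(\mathrm{Quad}_mA)$ is the vector space of affine functionals $\mathrm{Quad}_mA\to\mathbb R$; its dual is the linear hull $\widehat{\mathrm{Quad}_mA}$, in which $\mathrm{Quad}_mA$ is embedded by evaluation ($\langle\delta,\bar v\rangle=\bar v(\delta)$). $u_m\in\widehat{\mathrm{Quad}_mA}$ is defined by $\langle u_m,\bar v\rangle=\bar v(\delta+u)-\bar v(\delta)$ (any $\delta\in\mathrm{Quad}_mA$). *)

(* Defs.v *)
From HB Require Import structures.
From mathcomp Require Import all_boot all_order all_algebra generic_quotient.
From mathcomp Require Import all_classical reals.
From mathcomp Require Import ring lra.

Set Implicit Arguments.
Unset Strict Implicit.
Unset Printing Implicit Defensive.
Import Order.TTheory GRing.Theory Num.Theory.
Local Open Scope ring_scope.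
Local Open Scope quotient_scope.

(* A real affine space is a nonempty set of points on which the additive group
   of a finite-dimensional real vector space V acts freely and transitively;
   [vec P Q] is the unique v with [translate P v = Q]. *)
HB.mixin Record isAffineSpace (R : realType) (V : vectType R) (A : Type) := {
  translate : A -> V -> A;
  vec : A -> A -> V;
  affine_nonempty : inhabited A;
  translateA : forall P v w, translate (translate P v) w = translate P (v + w);
  vecK : forall P Q, translate P (vec P Q) = Q;
  translateK : forall P v, vec P (translate P v) = v
}.

#[short(type="affineType")]
HB.structure Definition AffineSpace (R : realType) (V : vectType R) :=
  {A of isAffineSpace R V A}.

Section AffineBasics.
Context {R : realType} {V : vectType R} {A : affineType V}.
Implicit Types (P Q : A) (v w : V).

Lemma translate0 P : translate P (0 : V) = P.
Proof. by rewrite -[P in LHS](vecK P P) translateA addr0 vecK. Qed.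

Lemma vecxx P : vec P P = 0 :> V.
Proof. by rewrite -{2}[P]translate0 translateK. Qed.

Lemma vec_translate P Q v : vec P (translate Q v) = vec P Q + v.
Proof. by rewrite -{1}(vecK P Q) translateA translateK. Qed.

Definition origin : A := projT1 (cid (let: inhabits P := @affine_nonempty R V A in
  ex_intro (fun _ : A => True) P I)).

(* The affine combination (1 - b) P + b Q. *)
Definition bary P Q (b : R) : A := translate P (b *: vec P Q).

Lemma vec_bary O P Q b :
  vec O (bary P Q b) = vec O P + b *: (vec O Q - vec O P).
Proof.
by rewrite vec_translate -[in vec O Q](vecK P Q) vec_translate addrAC subrr add0r.
Qed.

Definition affine (f : A -> R) : Prop :=
  forall P Q a b, a + b = 1 -> f (bary P Q b) = a * f P + b * f Q.

Definition quadratic (d : A -> R) : Prop :=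
  forall P Q a b, a + b = 1 ->
    d (bary P Q b) =
      a * (a - b) * d P + b * (b - a) * d Q + 4 * a * b * d (bary P Q 2^-1).

Lemma affine_quadratic f : affine f -> quadratic f.
Proof.
move=> fA P Q a b ab1; have aE : a = 1 - b by rewrite -ab1 addrK.
rewrite (fA P Q _ _ ab1) (fA P Q 2^-1 2^-1); last by field.
by rewrite aE; field.
Qed.

Definition affinely_free (s : seq A) : bool :=
  if s is P :: s' then free [seq vec P Q | Q <- s'] else true.

End AffineBasics.

Definition is_referential (R : realType) (V : vectType R) (A : affineType V)
  (s : seq A) : bool := (size s == (\dim {: V}).+1) && affinely_free s.

Section Functions.
Context {R : realType} {V : vectType R} (A : affineType V).

Definition affine_pred : {pred A -> R^o} := fun f => `[< affine f >].
Definition quadratic_pred : {pred A -> R^o} := fun f => `[< quadratic f >].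

Fact affine_pred_closed : submod_closed affine_pred.
Proof.
split; first by apply/asboolP => P Q a b _ /=; rewrite !mulr0 addr0.
move=> k f g /asboolP fA /asboolP gA; apply/asboolP => P Q a b ab1.
by rewrite /= !fctE /= (fA _ _ _ _ ab1) (gA _ _ _ _ ab1) /GRing.scale/=; ring.
Qed.

Fact quadratic_pred_closed : submod_closed quadratic_pred.
Proof.
split; first by apply/asboolP => P Q a b _ /=; rewrite !mulr0 !addr0.
move=> k f g /asboolP fA /asboolP gA; apply/asboolP => P Q a b ab1.
by rewrite /= !fctE /= (fA _ _ _ _ ab1) (gA _ _ _ _ ab1) /GRing.scale/=; ring.
Qed.

HB.instance Definition _ :=
  GRing.isSubmodClosed.Build R (A -> R^o) affine_pred affine_pred_closed.
HB.instance Definition _ :=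
  GRing.isSubmodClosed.Build R (A -> R^o) quadratic_pred quadratic_pred_closed.

Record Aff := MkAff {aff_fun :> A -> R^o; _ : aff_fun \in affine_pred}.
HB.instance Definition _ := [isSub for aff_fun].
HB.instance Definition _ := [Choice of Aff by <:].
HB.instance Definition _ := [SubChoice_isSubZmodule of Aff by <:].
HB.instance Definition _ := [SubZmodule_isSubLmodule of Aff by <:].

Record Quad := MkQuad {quad_fun :> A -> R^o; _ : quad_fun \in quadratic_pred}.
HB.instance Definition _ := [isSub for quad_fun].
HB.instance Definition _ := [Choice of Quad by <:].
HB.instance Definition _ := [SubChoice_isSubZmodule of Quad by <:].
HB.instance Definition _ := [SubZmodule_isSubLmodule of Quad by <:].

Lemma affP (f : Aff) : affine f.
Proof. by case: f => f /= /asboolP. Qed.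

Lemma quadP (f : Quad) : quadratic f.
Proof. by case: f => f /= /asboolP. Qed.

Lemma affDE (f g : Aff) P : (f + g) P = f P + g P. Proof. by []. Qed.
Lemma affZE (k : R) (f : Aff) P : (k *: f) P = k * f P. Proof. by []. Qed.
Lemma quadDE (f g : Quad) P : (f + g) P = f P + g P. Proof. by []. Qed.
Lemma quadBE (f g : Quad) P : (f - g) P = f P - g P. Proof. by []. Qed.

Lemma aff_ext (f g : Aff) : (forall P, f P = g P) -> f = g.
Proof. by move=> fg; apply/val_inj/funext. Qed.

Lemma quad_ext (f g : Quad) : (forall P, f P = g P) -> f = g.
Proof. by move=> fg; apply/val_inj/funext. Qed.

(* The constant function 1, written u in the mathematics. *)
Fact aff1_proof : (fun=> 1 : R^o) \in affine_pred.
Proof. by apply/asboolP => P Q a b ab1; rewrite !mulr1. Qed.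
Definition aff1 : Aff := MkAff aff1_proof.

Definition quad_of_aff (f : Aff) : Quad :=
  MkQuad (asboolT (affine_quadratic (affP f))).

End Functions.
Arguments affine_pred {R V A}.
Arguments quadratic_pred {R V A}.
Arguments affP {R V A} f _ _ _ _ _.
Arguments quadP {R V A} f _ _ _ _ _.

Section VectAxiom.
Import VectorInternalTheory.
Lemma vect_axiom_bij (R : nzRingType) (W : vectType R) (U : lmodType R)
  (f : U -> W) : linear f -> bijective f -> Vector.axiom (dim W) U.
Proof.
move=> fL fB; exists (v2r \o f).
  have vL : linear (v2r : W -> _) by exact: linearP.
  by move=> k x y; rewrite -vL -fL.
apply: bij_comp fB; exists (r2v : _ -> W).
  exact: v2rK.
exact: r2vK.
Qed.
End VectAxiom.

(* Finite-dimensionality of Aff A, through Aff A = R x V^*. *)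
Section AffVector.
Context {R : realType} {V : vectType R} (A : affineType V).
Let O : A := origin.

Definition aff_dir (f : Aff A) (v : V) : R^o := f (translate O v) - f O.

Fact aff_dir_linear f : linear (aff_dir f).
Proof.
have halfE (p q : V) : p + 2^-1 *: (q - p) = 2^-1 *: (p + q).
  rewrite scalerBr scalerDr addrCA [RHS]addrC; congr (_ + _).
  by rewrite -{1}[p]scale1r -scalerBl; congr (_ *: _); field.
have fZ a x : aff_dir f (a *: x) = a *: aff_dir f x.
  have := affP f O (translate O x) (1 - a) a (subrK _ _).
  by rewrite /bary /aff_dir translateK /GRing.scale /= => ->; ring.
have fD x y : aff_dir f (x + y) = aff_dir f x + aff_dir f y.
  suff: aff_dir f (2 *: (x + y)) = aff_dir f (2 *: x) + aff_dir f (2 *: y).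
    rewrite !fZ /GRing.scale /=; lra.
  have e := affP f (translate O (4 *: x)) (translate O (4 *: y)) 2^-1 2^-1.
  have -> : 2 *: (x + y) = 2^-1 *: (4 *: x + 4 *: y).
    by rewrite -scalerDr scalerA; congr (_ *: _); field.
  rewrite !fZ; move: e; rewrite /aff_dir.
  have -> : bary (translate O (4 *: x)) (translate O (4 *: y)) 2^-1 =
    translate O (2^-1 *: (4 *: x + 4 *: y)).
    rewrite -(vecK O (bary _ _ _)) vec_bary !translateK; congr translate.
    exact: halfE.
  move=> /(_ ltac:(by field)) e.
  have := fZ 4 x; have := fZ 4 y; have := fZ 2^-1 (4 *: x + 4 *: y).
  rewrite /aff_dir /GRing.scale /=; lra.
by move=> a x y; rewrite fD fZ.
Qed.
HB.instance Definition _ f :=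
  GRing.isLinear.Build R V R^o _ (aff_dir f) (aff_dir_linear f).

Definition aff_split (f : Aff A) : R^o * 'Hom(V, R^o) :=
  (f O, linfun (aff_dir f)).

Fact aff_split_linear : linear aff_split.
Proof.
move=> k f g; congr pair; apply/lfunP => v.
rewrite add_lfunE scale_lfunE !lfunE /= /aff_dir !affDE !affZE /GRing.scale /=.
by ring.
Qed.

Fact aff_join_proof (x : R^o * 'Hom(V, R^o)) :
  (fun P : A => x.1 + x.2 (vec O P)) \in affine_pred.
Proof.
apply/asboolP => P Q a b ab1; have aE : a = 1 - b by rewrite -ab1 addrK.
by rewrite vec_bary linearD linearZ linearB /= /GRing.scale /= aE; ring.
Qed.

Fact aff_split_bij : bijective aff_split.
Proof.
exists (fun x => MkAff (aff_join_proof x)) => [f|[c h]].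
  by apply: aff_ext => P /=; rewrite lfunE /= /aff_dir vecK addrC subrK.
congr pair => /=.
  by rewrite -[O in vec _ O]translate0 translateK linear0 addr0.
apply/lfunP => v; rewrite lfunE /= /aff_dir /= translateK.
rewrite -[O in vec _ O]translate0 translateK linear0; ring.
Qed.

Fact aff_vect_iso :
  Vector.axiom (dim [the vectType R of (R^o * 'Hom(V, R^o))%type]) (Aff A).
Proof. exact: vect_axiom_bij aff_split_linear aff_split_bij. Qed.
HB.instance Definition _ := Lmodule_hasFinDim.Build R (Aff A) aff_vect_iso.

End AffVector.

(* Existence of the hessian: a function that is quadratic along lines is a
   polynomial of degree at most 2. *)
Section HessianExistence.
Context {R : realType} {V : vectType R} {A : affineType V}.
Variables (d : A -> R) (dQ : quadratic d) (P : A).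
Let F (v : V) : R := d (translate P v).
Implicit Types (x y u v w : V) (t : R).

Let F_line x v t : F (x + t *: v) =
  (1 - t / 2) * (1 - t) * F x + t / 2 * (t - 1) * F (x + 2 *: v)
  + t * (2 - t) * F (x + v).
Proof.
have baryE b : bary (translate P x) (translate P (x + 2 *: v)) b =
    translate P (x + (2 * b) *: v).
  rewrite -[LHS](vecK P) vec_bary !translateK addrAC subrr add0r scalerA.
  by rewrite [b * 2]mulrC.
have := dQ (translate P x) (translate P (x + 2 *: v)) (subrK (t / 2) 1).
rewrite !baryE divff ?pnatr_eq0// scale1r [2 * _]mulrC divfK ?pnatr_eq0//.
by rewrite /F => ->; field.
Qed.

(* The second difference of F does not depend on the base point. *)
Let second_diff1 x u v : F (x + v + u + u) - 2 * F (x + v + u) + F (x + v) =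
  F (x + u + u) - 2 * F (x + u) + F x.
Proof.
pose pt (a b : R) := x + (a *: u + b *: v).
have ptD a b s t k : pt a b + k *: (s *: u + t *: v) = pt (a + k * s) (b + k * t).
  by rewrite /pt -addrA scalerDr !scalerA addrACA -!scalerDl.
have third s t a b a1 b1 a2 b2 a3 b3 :
    a1 = a + s -> b1 = b + t -> a2 = a + 2 * s -> b2 = b + 2 * t ->
    a3 = a + 3 * s -> b3 = b + 3 * t ->
    F (pt a3 b3) = F (pt a b) - 3 * F (pt a1 b1) + 3 * F (pt a2 b2).
  move=> -> -> -> -> -> ->; have := F_line (pt a b) (s *: u + t *: v) 3.
  have := ptD a b s t 1; rewrite scale1r !mul1r => pt1.
  by rewrite !ptD pt1 => ->; field.
pose f (i j : nat) := F (pt i%:R j%:R).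
have row i j : f i.+3 j = f i j - 3 * f i.+1 j + 3 * f i.+2 j.
  by apply: (third 1 0); ring.
have col i j : f i j.+3 = f i j - 3 * f i j.+1 + 3 * f i j.+2.
  by apply: (third 0 1); ring.
have dia i j : f i.+3 j.+3 = f i j - 3 * f i.+1 j.+1 + 3 * f i.+2 j.+2.
  by apply: (third 1 1); ring.
have anti i j : f i.+3 j = f i j.+3 - 3 * f i.+1 j.+2 + 3 * f i.+2 j.+1.
  by apply: (third 1 (-1)); ring.
have fE i j : f i j = F (x + (u *+ i + v *+ j)) by rewrite /f /pt !scaler_nat.
suff: f 2 1 - 2 * f 1 1 + f 0 1 = f 2 0 - 2 * f 1 0 + f 0 0.
  rewrite !fE !mulr0n !mulr1n !mulr2n !add0r !addr0 !addrA.
  by rewrite ![x + v + u]addrAC [x + u + v + u]addrAC.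
have := (row 0 0, row 0 1, row 0 2, row 0 3, row 1 3).
have := (col 0 0, col 1 0, col 2 0, col 3 0).
have := (dia 0 0, dia 1 0, anti 0 0).
move=> [[e1 e2] e3] [[[e4 e5] e6] e7] [[[[e8 e9] e10] e11] e12].
lra.
Qed.

Let q (u : V) : R := F (u + u) - 2 * F u + F 0.

Let second_diff x u : F (x + u) + F (x - u) = 2 * F x + q u.
Proof.
have := second_diff1 0 u (x - u); rewrite !add0r -/(q u) subrK; lra.
Qed.

Definition hess_at (u v : V) : R := F (u + v) - F u - F v + F 0.

Let cross_diff x u v :
  F (x + u + v) - F (x + u) - F (x + v) + F x = hess_at u v.
Proof.
suff cross y : F (y + u + v) - F (y + u) - F (y + v) + F y =
    q (2^-1 *: (u + v)) - q (2^-1 *: (u - v)).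
  by rewrite cross -(cross 0) !add0r.
pose c := y + 2^-1 *: (u + v).
have half (w : V) : 2^-1 *: w + 2^-1 *: w = w.
  by rewrite -scalerDl (_ : 2^-1 + 2^-1 = 1) ?scale1r //; field.
have := second_diff c (2^-1 *: (u + v)); have := second_diff c (2^-1 *: (u - v)).
have -> : c + 2^-1 *: (u + v) = y + u + v by rewrite -addrA half addrA.
have -> : c - 2^-1 *: (u + v) = y by rewrite addrK.
have -> : c + 2^-1 *: (u - v) = y + u.
  by rewrite -addrA -scalerDr addrACA subrr addr0 scalerDr half.
have -> : c - 2^-1 *: (u - v) = y + v.
  rewrite -addrA -scalerBr opprB [u + v]addrC addrACA subrr addr0.
  by rewrite scalerDr half.
lra.
Qed.

Fact hess_at_sym u v : hess_at u v = hess_at v u.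
Proof. by rewrite /hess_at [v + u]addrC; ring. Qed.

Fact hess_at_linear v : linear_for *%R (hess_at^~ v).
Proof.
have hD x y w : hess_at (x + y) w = hess_at x w + hess_at y w.
  by rewrite -(cross_diff x y w) /hess_at; ring.
move=> t x y; rewrite hD; congr (_ + _).
have h2 : hess_at (2 *: x) v = 2 * hess_at x v.
  by rewrite scaler_nat mulr2n hD; ring.
have := F_line v x t; have := F_line 0 x t; rewrite !add0r.
have h x' : F (v + x') = hess_at x' v + F x' + F v - F 0.
  by rewrite /hess_at [v + x']addrC; ring.
rewrite !h h2 => ->; lra.
Qed.

Fact hess_atE x v : F (x + v) + F (x - v) - 2 * F x = hess_at v v.
Proof.
by have := second_diff x v; rewrite /hess_at /q => ->; ring.
Qed.

End HessianExistence.

Section Metrics.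
Context {R : realType} {V : vectType R} (A : affineType V).
Implicit Types (d : Quad A) (P Q : A).

(* [bary Q P 2] is the reflected point 2P - Q. *)
Definition is_hess d (g : V -> V -> R) : Prop :=
  forall P Q, 2^-1 * (d Q + d (bary Q P 2)) - d P = 2^-1 * g (vec P Q) (vec P Q).

Lemma hess_exists d : exists g : {symmetric V}, is_hess d g.
Proof.
pose g : V -> V -> R := hess_at d origin.
have gC u v : g u v = (-1) ^+ false * idfun (g v u).
  by rewrite expr0 mul1r /= /g hess_at_sym.
have gB : bilinear_for *%R *%R g.
  split=> [v|v] k x y; first exact: (hess_at_linear (quadP d)).
  have gE z : g v z = g z v by exact: hess_at_sym.
  by rewrite !gE; exact: (hess_at_linear (quadP d)).
pose gb := bilinear_isBilinear.Build R V V R *%R *%R g gB.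
pose gh := isHermitianSesquilinear.Build R V false idfun g gC.
pose gs : {symmetric V} := HB.pack g gb gh.
exists gs => P Q.
have := hess_atE (quadP d) origin (vec origin P) (vec P Q).
have -> : translate origin (vec origin P + vec P Q) = Q.
  by rewrite -translateA !vecK.
have -> : translate origin (vec origin P - vec P Q) = bary Q P 2.
  rewrite -[RHS](vecK origin) vec_bary -[in vec origin Q](vecK P Q).
  rewrite vec_translate opprD addrA subrr add0r scalerN.
  by rewrite -addrA -{2}[vec P Q]scale1r -scaleNr -scalerDl; congr
    (translate _ (_ + _)); rewrite -scaleN1r; congr (_ *: _); ring.
by rewrite vecK -/(g _ _) /= => <-; field.
Qed.

Definition hess d : {symmetric V} := projT1 (cid (hess_exists d)).

Lemma hessE d : is_hess d (hess d).
Proof. exact: projT2 (cid (hess_exists d)). Qed.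

Lemma is_hess_unique d (g h : {symmetric V}) : is_hess d g -> is_hess d h ->
  forall v w, g v w = h v w.
Proof.
move=> dg dh.
have diag v : g v v = h v v.
  have := dg origin (translate origin v); rewrite (dh origin) translateK; lra.
have polar (f : {symmetric V}) v w : f (v + w) (v + w) = f v v + 2 * f v w + f w w.
  have fC x y : f x y = f y x by rewrite hermC expr0 mul1r.
  have fD x y z : f (x + y) z = f x z + f y z by exact: linearDl.
  by rewrite fD ![f _ (v + w)]fC !fD [f w v]fC; ring.
move=> v w; have := diag (v + w); have := diag v; have := diag w.
rewrite !polar; lra.
Qed.

Lemma hess0_affine d : is_hess d (fun _ _ => 0) -> affine d.
Proof.
move=> d0 P Q a b ab1; have aE : a = 1 - b by rewrite -ab1 addrK.
rewrite (quadP d _ _ _ _ ab1).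
have := d0 (bary P Q 2^-1) P.
have -> : bary P (bary P Q 2^-1) 2 = Q.
  rewrite -[LHS](vecK P) !vec_bary vecxx !add0r !subr0 scalerA.
  by rewrite divff ?pnatr_eq0// scale1r vecK.
by rewrite aE; move=> e; have {e} -> : d (bary P Q 2^-1) = 2^-1 * (d P + d Q); lra.
Qed.

Definition met_rel : rel (Quad A) := fun d1 d2 => `[< affine (d1 - d2) >].

Fact met_rel_equiv : equiv_class_of met_rel.
Proof.
split=> [d|d1 d2|d2 d1 d3].
- by apply/asboolP; rewrite subrr => P Q a b _; rewrite !mulr0 addr0.
- by apply/asboolP/asboolP => dA P Q a b ab1; have := dA P Q a b ab1;
    rewrite !quadBE => e; apply: oppr_inj; rewrite !opprB e; ring.
- move=> /asboolP dA /asboolP dB; apply/asboolP => P Q a b ab1.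
  have := dA P Q a b ab1; have := dB P Q a b ab1; rewrite !quadBE; lra.
Qed.
Canonical met_equiv := EquivRelPack met_rel_equiv.

Definition Met : Type := {eq_quot met_rel}.
HB.instance Definition _ := Choice.on Met.
HB.instance Definition _ := EqQuotient.on Met.

Record Quadm (m : Met) :=
  MkQuadm {quadm_quad :> Quad A; _ : \pi_Met quadm_quad == m}.
HB.instance Definition _ m := [isSub for @quadm_quad m].
HB.instance Definition _ m := [Choice of Quadm m by <:].

Lemma quadm_sub_affine m (d1 d2 : Quadm m) :
  affine ((d1 : Quad A) - (d2 : Quad A)).
Proof.
apply/asboolP; rewrite -[`[< _ >]]/(met_rel d1 d2).
by apply/(@eqmodP _ met_equiv)/eqP; case: d1 d2 => [x /eqP /= xm] [y /eqP /= ym];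
  apply/eqP; rewrite -/Met xm ym.
Qed.

Fact quadm_addr_proof m (d : Quadm m) (f : Aff A) :
  \pi_(Met) ((d : Quad A) + quad_of_aff f) == m.
Proof.
case: d => d /= /eqP <-; apply/eqP/(@eqmodP _ met_equiv)/asboolP.
by rewrite addrAC subrr add0r; exact: affP.
Qed.

Definition quadm_add m (d : Quadm m) (f : Aff A) : Quadm m :=
  MkQuadm (quadm_addr_proof d f).

Definition quadm_sub m (d1 d2 : Quadm m) : Aff A :=
  MkAff (asboolT (quadm_sub_affine d2 d1)).

Fact quadm_inhabited m : inhabited (Quadm m).
Proof. by constructor; apply: (@MkQuadm m (repr m)); rewrite reprK. Qed.

Fact quadm_addA m (d : Quadm m) f g :
  quadm_add (quadm_add d f) g = quadm_add d (f + g).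
Proof. by apply/val_inj/quad_ext => P; exact/esym/addrA. Qed.

Fact quadm_subK m (d1 d2 : Quadm m) : quadm_add d1 (quadm_sub d1 d2) = d2.
Proof. by apply/val_inj/quad_ext => P; exact: (subrKC (d1 P) (d2 P)). Qed.

Fact quadm_addK m (d : Quadm m) f : quadm_sub d (quadm_add d f) = f.
Proof.
have addDl (a b : R^o) : a + b - a = b by rewrite addrAC subrr add0r.
by apply: aff_ext => P; exact: addDl.
Qed.

HB.instance Definition _ m := isAffineSpace.Build R (Aff A) (Quadm m)
  (quadm_inhabited m) (@quadm_addA m) (@quadm_subK m) (@quadm_addK m).

(* All members of the class m have the same hessian, see quadm_hess. *)
Definition met_hess (m : Met) : {symmetric V} := hess (repr m).

Lemma quadm_hess m (d : Quadm m) v w : hess d v w = met_hess m v w.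
Proof.
have rm : \pi_Met (repr m) == m by rewrite reprK.
apply: (@is_hess_unique (repr m)); last exact: hessE.
move=> P Q; rewrite -hessE.
have := quadm_sub_affine d (MkQuadm rm) Q P (subrK 2 1).
rewrite !quadBE /=; lra.
Qed.

Definition met_nondegenerate (m : Met) : bool := nondegenerate (met_hess m).

Lemma met_nondegenerateP m :
  reflect (forall v, (forall w, met_hess m v w = 0) -> v = 0)
    (met_nondegenerate m).
Proof.
apply: (iffP eqP) => [rad0 v vm|rad0].
  by apply/eqP; rewrite -memv0 -rad0; apply/mem_orthovP => w _; exact: vm.
apply/eqP; rewrite -subv0; apply/subvP => v /mem_orthovP vm.
by rewrite memv0; apply/eqP/rad0 => w; apply: vm; exact: memvf.
Qed.

Definition delta_fun (m : Met) P (Q : A) : R^o :=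
  2^-1 * met_hess m (vec P Q) (vec P Q).

Fact form_quadratic (g : {symmetric V}) v w t :
  g (v + t *: w) (v + t *: w) = g v v + 2 * t * g v w + t ^+ 2 * g w w.
Proof.
have fC x y : g x y = g y x by rewrite hermC expr0 mul1r.
have fP x y z : g (x + t *: y) z = g x z + t * g y z.
  have -> : g (x + t *: y) z = g x z + g (t *: y) z by exact: linearDl.
  by congr (_ + _); exact: linearZl_LR.
by rewrite fP ![g _ (v + t *: w)]fC !fP [g w v]fC; ring.
Qed.

Fact form_quadratic1 (g : {symmetric V}) v w :
  g (v + w) (v + w) = g v v + 2 * g v w + g w w.
Proof.
by have := form_quadratic g v w 1; rewrite scale1r expr1n mulr1 mul1r.
Qed.

Fact delta_fun_quadratic m P : delta_fun m P \in quadratic_pred.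
Proof.
apply/asboolP => Q Q' a b ab1; have aE : a = 1 - b by rewrite -ab1 addrK.
have /(congr1 (vec P)) := vecK Q Q'; rewrite vec_translate => vQ'.
rewrite /delta_fun !vec_bary -vQ' addrAC subrr add0r !form_quadratic.
by rewrite form_quadratic1 aE; field.
Qed.

Definition delta_quad m P : Quad A := MkQuad (delta_fun_quadratic m P).

Fact delta_quad_met m P : \pi_Met (delta_quad m P) == m.
Proof.
rewrite -[m in X in _ == X]reprK; apply/eqP/(@eqmodP _ met_equiv)/asboolP.
apply: hess0_affine => Q Q'.
have := @hessE (repr m) Q Q'; rewrite !quadBE /= /delta_fun -/(met_hess m) => e.
have -> : vec P (bary Q' Q 2) = vec P Q + (-1) *: vec Q Q'.
  rewrite vec_bary -[in vec P Q'](vecK Q Q') vec_translate.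
  rewrite opprD addrA subrr add0r -addrA; congr (_ + _).
  by rewrite -[X in X + _]scale1r scalerN -scaleNr -scalerDl; congr (_ *: _); ring.
have -> : vec P Q' = vec P Q + vec Q Q' by rewrite -vec_translate vecK.
rewrite form_quadratic form_quadratic1; lra.
Qed.

Definition delta m P : Quadm m := MkQuadm (delta_quad_met m P).

End Metrics.

(* The linear hull of an affine space B: the dual of Aff B, in which B is
   embedded by evaluation. *)
Definition hull (R : realType) (V : vectType R) (B : affineType V) :=
  'Hom(Aff B, R^o).

Section Hull.
Context {R : realType} {V : vectType R} (B : affineType V).

Definition eval_at (P : B) (f : Aff B) : R^o := f P.

Fact eval_at_linear P : linear (eval_at P).
Proof. by []. Qed.
HB.instance Definition _ P :=
  GRing.isLinear.Build R (Aff B) R^o _ (eval_at P) (eval_at_linear P).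

Definition embed (P : B) : hull B := linfun (eval_at P).

Lemma embedE P f : embed P f = f P.
Proof. by rewrite lfunE. Qed.

End Hull.

Section UnitVector.
Context {R : realType} {V : vectType R} (A : affineType V) (m : Met A).

(* The base point of the difference is irrelevant, see umetE. *)
Definition umet_fun (f : Aff (Quadm m)) : R^o :=
  f (translate origin (aff1 A)) - f origin.

Fact umet_fun_linear : linear umet_fun.
Proof.
by move=> k f g; rewrite /umet_fun !affDE !affZE /GRing.scale /=; ring.
Qed.
HB.instance Definition _ :=
  GRing.isLinear.Build R (Aff (Quadm m)) R^o _ umet_fun umet_fun_linear.

Definition umet : hull (Quadm m) := linfun umet_fun.

Lemma umetE (f : Aff (Quadm m)) (d : Quadm m) :
  umet f = f (translate d (aff1 A)) - f d.
Proof.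
rewrite lfunE /= /umet_fun -(vecK origin d) translateA.
have := aff_dir_linear f 1 (vec origin d) (aff1 A).
rewrite !scale1r /aff_dir; lra.
Qed.

End UnitVector.

(* Main.v *)
Require Import Defs.
From HB Require Import structures.
From mathcomp Require Import all_boot all_order all_algebra.
From mathcomp Require Import all_classical reals.
From mathcomp Require Import ring lra.

(** The hull of Quad_m A is the dual of Aff (Quad_m A), so its dimension is
    that of Aff (Quad_m A), namely n + 2, and it suffices that the n + 2
    given vectors are linearly independent.

    Suppose that c u_m + \sum_i k_i delta_(R_i) = 0 in the hull, that is,
    that this combination vanishes on every affine functional of Quad_m A.
    Two kinds of functionals are enough. The constant functional 1 gives
    \sum_i k_i = 0. The functional sending d in Quad_m A to d(Q), for a
    point Q of A, gives c + \sum_i k_i delta_(R_i)(Q) = 0. With Q = O + p,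
    the term delta_(R_i)(O + p) exceeds delta_(R_i)(O) by g(p, p) / 2 -
    g(x_i, p), where x_i is the vector from O to R_i ([delta_translate]). As
    \sum_i k_i = 0, the terms in g(p, p) cancel, and comparing p with 0
    leaves g(\sum_i k_i x_i, p) = 0 for every p. Non-degeneracy turns this
    into \sum_i k_i x_i = 0, and affine independence of the R_i then gives
    k_i = 0 for all i ([affinely_free_coef]), hence c = 0. *)

Set Implicit Arguments.
Unset Strict Implicit.
Unset Printing Implicit Defensive.
Import Order.TTheory GRing.Theory Num.Theory.
Local Open Scope ring_scope.

Lemma vec_opp (R : realType) (V : vectType R) (A : affineType V) (P Q : A) :
  vec P Q = - vec Q P.
Proof.
by apply/eqP; rewrite eq_sym -subr_eq0 -opprD oppr_eq0 -vec_translate vecK vecxx.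
Qed.

(** This form of affine independence is symmetric in the points, whereas
    [affinely_free] singles out the first one.  Since the weights sum to zero,
    the hypothesis on the vectors does not depend on O, which may therefore be
    moved to the first point. *)
Lemma affinely_free_coef (R : realType) (V : vectType R) (A : affineType V)
    (s : seq A) (O : A) (k : 'I_(size s) -> R) :
  affinely_free s -> \sum_i k i = 0 ->
  \sum_i k i *: vec O (tnth (in_tuple s) i) = 0 -> forall i, k i = 0.
Proof.
case: s k => [|P s] k; first by move=> _ _ _ [].
move=> sF k0 kv0.
have kP : \sum_i k i *: vec P (tnth (in_tuple (P :: s)) i) = 0.
  transitivity (\sum_i (k i *: vec O P + k i *: vec P (tnth (in_tuple (P :: s)) i))).
    by rewrite big_split /= -scaler_suml k0 scale0r add0r.
  rewrite -[RHS]kv0; apply: eq_bigr => i _.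
  by rewrite -scalerDr -vec_translate vecK.
have kS : forall i, k (lift ord0 i) = 0.
  have /freeP sFk : free (map_tuple (vec P) (in_tuple s)) := sF.
  apply: (sFk (fun i => k (lift ord0 i))).
  rewrite -[RHS]kP big_ord_recl (tnth_nth P) vecxx scaler0 add0r.
  apply: eq_bigr => i _; rewrite -tnth_nth tnth_map; congr (_ *: vec _ _).
  by rewrite !(tnth_nth P).
have k00 : k ord0 = 0.
  by rewrite -[RHS]k0 big_ord_recl big1 ?addr0// => i _; exact: kS.
by move=> i; case: (unliftP ord0 i) => [j ->|->].
Qed.

(** The quadratic part of delta^m_P depends on m only, so that it drops out of
    a combination of such functions whose weights sum to zero. *)
Lemma delta_translate (R : realType) (V : vectType R) (A : affineType V)
    (m : Met A) (P O : A) (p : V) :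
  delta_fun m P (translate O p) =
  delta_fun m P O + 2^-1 * met_hess m p p - met_hess m (vec O P) p.
Proof.
rewrite /delta_fun vec_translate form_quadratic1 (vec_opp O P).
have -> : met_hess m (- vec P O) p = - met_hess m (vec P O) p by exact: linearNl.
by field.
Qed.

Section EvaluationFunctional.
Context {R : realType} {V : vectType R} (A : affineType V) (m : Met A) (Q : A).

Fact point_eval_proof : (fun d : Quadm m => (d : Quad A) Q) \in affine_pred.
Proof.
apply/asboolP => d d' a b ab1; have -> : a = 1 - b by rewrite -ab1 addrK.
have -> : (bary d d' b : Quad A) Q = d Q + b * (d' Q - d Q) by [].
by ring.
Qed.

Definition point_eval : Aff (Quadm m) := MkAff point_eval_proof.

Lemma umet_point_eval : umet m point_eval = 1.
Proof. by rewrite (umetE _ origin) /= fctE addrAC subrr add0r. Qed.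

Lemma umet_aff1 : umet m (aff1 (Quadm m)) = 0.
Proof. by rewrite (umetE _ origin) /= subrr. Qed.

End EvaluationFunctional.

(** An affine function amounts to its value at a point and its linear part. *)
Lemma dim_Aff (R : realType) (V : vectType R) (A : affineType V) :
  \dim {: Aff A} = (\dim {: V}).+1.
Proof.
rewrite !dimvf; transitivity (1 + dim V * 1)%N; last by rewrite muln1.
by [].
Qed.

Lemma dim_hull (R : realType) (V : vectType R) (A : affineType V) :
  \dim {: hull A} = (\dim {: V}).+1.
Proof.
rewrite -(dim_Aff A) !dimvf; transitivity (dim (Aff A) * 1)%N; last exact: muln1.
by [].
Qed.

(** The number of points is arbitrary here: affine functionals on Quad_m A
    separate the vectors without any count of dimensions. *)
Lemma free_umet_delta (R : realType) (V : vectType R) (A : affineType V)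
    (m : Met A) (s : seq A) :
  met_nondegenerate m -> affinely_free s ->
  free (umet m :: [seq embed (delta m P) | P <- s]).
Proof.
move=> /met_nondegenerateP gN sF.
pose X := map_tuple (fun P => embed (delta m P)) (in_tuple s).
suff : free (cons_tuple (umet m) X) by [].
apply/freeP => c c0.
pose k i := c (lift ord0 i); pose x := tnth (in_tuple s).
have {}c0 : c ord0 *: umet m + \sum_i k i *: embed (delta m (x i)) = 0.
  rewrite -[RHS]c0 big_ord_recl; congr (_ + _).
  by apply: eq_bigr => i _; rewrite -tnth_nth tnthS tnth_map.
have cf (f : Aff (Quadm m)) : c ord0 * umet m f + \sum_i k i * f (delta m (x i)) = 0.
  have := congr1 (fun h : hull _ => h f) c0.
  rewrite add_lfunE scale_lfunE sum_lfunE zero_lfunE => e; rewrite -[RHS]e.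
  by congr (_ + _); apply: eq_bigr => i _; rewrite scale_lfunE embedE.
have k0 : \sum_i k i = 0.
  have := cf (aff1 _); rewrite umet_aff1 mulr0 add0r => e; rewrite -[RHS]e.
  by apply: eq_bigr => i _; rewrite mulr1.
pose O : A := origin.
have cP Q : c ord0 + \sum_i k i * delta_fun m (x i) Q = 0.
  by have := cf (point_eval m Q); rewrite umet_point_eval mulr1.
have kx : \sum_i k i *: vec O (x i) = 0.
  (* The combination takes the same value at O and at O + p. *)
  apply: gN => p.
  have -> : met_hess m (\sum_i k i *: vec O (x i)) p =
      \sum_i k i * met_hess m (vec O (x i)) p.
    rewrite linear_sumlz; apply: eq_bigr => i _; exact: linearZl_LR.
  have := cP (translate O p).
  under eq_bigr => i _ do rewrite delta_translate mulrBr mulrDr.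
  rewrite sumrB big_split /= -mulr_suml k0 mul0r.
  have := cP O; lra.
have k_eq0 := affinely_free_coef sF k0 kx.
move=> i; case: (unliftP ord0 i) => [j ->|->]; first exact: k_eq0.
by rewrite -[RHS](cP O) big1 ?addr0// => j _; rewrite k_eq0 mul0r.
Qed.

Theorem proposition5p8 (R : realType) (V : vectType R) (A : affineType V)
  (m : Met A) (r : seq A) :
  met_nondegenerate m -> is_referential r ->
  basis_of {: hull (Quadm m)}
    (rcons [seq embed (delta m P) | P <- r] (umet m)).
Proof.
move=> mN /andP[/eqP size_r rF].
rewrite basisEfree subvf dim_hull dim_Aff size_rcons size_map size_r leqnn !andbT.
by rewrite (perm_free (permEl (perm_rcons _ _))) free_umet_delta.
Qed.
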